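(* Let $X$ be a coded shift with generating set $\mathcal{G}$. Suppose that $h_\mu(f)=0$ for all $\mu\in\mathcal{M}_X$ with $\mu(X_{\rm lim})=1$. Furthermore, assume that for any $\phi\in C(X,\mathbb{R})$ with $P_{\rm top}(\phi)=P_{\rm lim}(\phi)$, there exists a sequence of periodic point measures $\mu_k$ supported on $X_{\rm seq}$ such that $$d\Big({\rm supp}\,\mu_k,\ \bigcup_{\mu\in\mathcal{M}_X,\ \mu(X_{\rm lim})=1}{\rm supp}\,\mu\Big)>0\quad\text{for all }k\ge1,$$ and $P_{\mu_k}(\phi)\to P_{\rm top}(\phi)$ as $k\to\infty$. Then $FSSP(X)=C(X,\mathbb{R})$.
   Context: $f$ is the left shift on $\mathcal{A}^{\mathbb{Z}}$, $\mathcal{A}$ a finite alphabet, with the metric $d(x,y)=\theta^{\min\{|k|:x_k\neq y_k\}}$ for a fixed $0<\theta<1$ (and $d(x,x)=0$); for sets, $d(A,B)=\inf\{d(x,y):x\in A,y\in B\}$. For a countable set $\mathcal{G}$ of finite words over $\mathcal{A}$, $X_{\rm seq}$ is the set of all bi-infinite concatenations of elements of $\mathcal{G}$ (arbitrary position of the origin), the coded shift with generating set $\mathcal{G}$ is $X=\overline{X_{\rm seq}}$, and $X_{\rm lim}=X\setminus X_{\rm seq}$. $\mathcal{M}_X$ is the set of $f$-invariant Borel probability measures on $X$. For a periodic point $x$ of prime period $n$, its periodic point measure is $\frac1n(\delta_x+\dots+\delta_{f^{n-1}(x)})$. For $\phi\in C(X,\mathbb{R})$: $P_\mu(\phi)=h_\mu(f)+\int\phi\,d\mu$;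 $P_{\rm top}(\phi)=\sup_{\mu\in\mathcal{M}_X}P_\mu(\phi)$ is the topological pressure; $P_{\rm seq}(\phi)=\sup\{P_\mu(\phi):\mu\in\mathcal{M}_X,\mu(X_{\rm seq})=1\}$; $P_{\rm lim}(\phi)=\sup\{P_\mu(\phi):\mu\in\mathcal{M}_X,\mu(X_{\rm lim})=1\}$ (with $\sup\emptyset=-\infty$). $FSSP(X)$ is the closure in $C(X,\mathbb{R})$ (supremum norm) of the set of $\phi$ with $P_{\rm seq}(\phi)>P_{\rm lim}(\phi)$. *)

(* Defs.v *)
From HB Require Import structures.
From mathcomp Require Import all_boot all_order all_algebra.
From mathcomp Require Import all_classical all_reals all_analysis.

Set Implicit Arguments.
Unset Strict Implicit.
Unset Printing Implicit Defensive.

Import Order.TTheory GRing.Theory Num.Theory.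
Import numFieldNormedType.Exports.

Local Open Scope classical_set_scope.
Local Open Scope ring_scope.

(* Nonempty finite alphabets: measurable types are required to be pointed. *)
#[short(type="alphabetType")]
HB.structure Definition Alphabet := {A of Finite A & Pointed A}.

Definition fullshift (A : alphabetType) : Type := int -> A.

(* The product of the discrete topologies, i.e. the topology of the metric
   [shift_dist] below (lemma [nbhs_shift_dist]), and its Borel sets. *)
HB.instance Definition _ (A : alphabetType) :=
  Topological.copy (fullshift A) {ptws int -> discrete_topology A}.
HB.instance Definition _ (A : alphabetType) :=
  Pointed.copy (fullshift A) (int -> A).
HB.instance Definition _ (A : alphabetType) :=
  Measurable.copy (fullshift A) (g_sigma_algebraType (@open (fullshift A))).

Section entropy.
Context d (T : measurableType d) (R : realType).
Implicit Types (f : T -> T) (mu : probability T R).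

(* A finite partition is given by its labelling function [xi]; empty cells are
   harmless since [ln 0 = 0]. *)
Definition partition_entropy mu (I : finType) (xi : T -> I) : R :=
  - \sum_(i : I) fine (mu (xi @^-1` [set i])) * ln (fine (mu (xi @^-1` [set i]))).

Definition iterated_partition f (n : nat) (I : finType) (xi : T -> I) :
    T -> {ffun 'I_n -> I} :=
  fun x => [ffun j : 'I_n => xi (iter j f x)].

Definition entropy_of_partition f mu (I : finType) (xi : T -> I) : R :=
  limn (fun n => n%:R^-1 * partition_entropy mu (iterated_partition f n xi)).

Definition entropy f mu : \bar R :=
  ereal_sup [set h | exists (k : nat) (xi : T -> 'I_k),
    (forall i, measurable (xi @^-1` [set i])) /\
    h = (entropy_of_partition f mu xi)%:E].

Definition invariant_measure f mu : Prop :=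
  forall B, measurable B -> mu (f @^-1` B) = mu B.

(* [mu Y = 1]; the set [Y] is not required to be Borel, in which case this is
   to be read with respect to the completion of [mu]. *)
Definition carried_by mu (Y : set T) : Prop := mu.-negligible (~` Y).

End entropy.

Section shift_space.
Context (R : realType) (A : alphabetType).
Implicit Types (x y : fullshift A) (X Y : set (fullshift A)).
Implicit Types (mu : probability (fullshift A) R) (phi : fullshift A -> R).

Definition left_shift x : fullshift A := fun k => x (k + 1).

Definition shift_dist (theta : R) x y : R :=
  if pselect (exists n, `[< exists k : int, x k != y k /\ `|k|%N = n >]) is left P
  then theta ^+ ex_minn P else 0.

Lemma shift_dist_lt (theta : R) x y (n : nat) : 0 < theta -> theta < 1 ->
  shift_dist theta x y < theta ^+ n <->
  (forall k : int, (`|k| <= n)%N -> y k = x k).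
Proof.
move=> t0 t1; rewrite /shift_dist; case: pselect => [P|nP]; last first.
  split=> [_ k _|_]; last exact: exprn_gt0.
  apply/eqP; rewrite eq_sym; apply: contrapT => /negP xy; apply: nP.
  by exists `|k|%N; apply/asboolP; exists k.
case: ex_minnP => m /asboolP[k [xk km]] min_m.
rewrite ltr_iXn2l //; split=> [nm j jn|agree].
  apply/eqP; rewrite eq_sym; apply: contrapT => /negP xy.
  have : (m <= `|j|)%N by apply: min_m; apply/asboolP; exists j.
  by move=> /leq_trans/(_ jn); rewrite leqNgt nm.
by rewrite ltnNge -km; apply/negP => /agree kk; rewrite kk eqxx in xk.
Qed.

Lemma nbhs_shift_dist (theta : R) x (U : set (fullshift A)) :
  0 < theta -> theta < 1 ->
  nbhs x U <->
  exists2 e : R, 0 < e & [set y | shift_dist theta x y < e] `<=` U.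
Proof.
move=> t0 t1; split; last first.
  move=> [e e0 eU].
  have [n ne] : exists n, theta ^+ n < e.
    have : theta ^+ n @[n --> \oo] --> (0 : R).
      by apply: cvg_expr; rewrite gtr0_norm.
    move=> /cvgrPdist_lt/(_ _ e0)[n _ /(_ n (leqnn _))] /=.
    by rewrite sub0r normrN ger0_norm ?exprn_ge0 ?ltW//; exists n.
  have agree_nbhs (k : int) : nbhs x [set y : fullshift A | y k = x k].
    apply: (@proj_continuous int (fun=> discrete_topology A) k x [set x k]).
    exact: discrete_set1.
  have : nbhs x [set y : fullshift A |
      forall i : 'I_(n.+1), y i%:Z = x i%:Z /\ y (- i%:Z) = x (- i%:Z)].
    apply: (@filter_forall _ _ _ (nbhs x)) => i.
    by apply: filterI; exact: agree_nbhs.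
  apply: filterS => y /= yx; apply: eU; apply: lt_trans ne.
  apply/shift_dist_lt => // k kn; have := yx (Ordinal (kn : (`|k| < n.+1)%N)).
  by case=> /= yk yNk; case: (intP k) yk yNk => [|m|m] //=; rewrite ?opprK.
pose F := filter_from [set e : R | 0 < e] (fun e => [set y | shift_dist theta x y < e]).
have FF : Filter F.
  apply: filter_from_filter; first by exists 1 => /=.
  move=> a b /= a0 b0; exists (Num.min a b); rewrite /= ?lt_min ?a0//.
  by move=> y /=; rewrite lt_min => /andP.
suff: F --> (x : {ptws int -> discrete_topology A}) by move=> + xU => /(_ U xU).
apply/cvg_sup => k V; rewrite nbhsE => -[B [[W _ <-] xW] WV].
exists (theta ^+ `|k|%N); first exact: exprn_gt0.
move=> y /shift_dist_lt yx; apply: WV => /=.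
by rewrite yx.
Qed.

Definition set_dist (theta : R) X Y : \bar R :=
  ereal_inf [set (shift_dist theta x y)%:E | x in X & y in Y].

Definition measure_support mu : set (fullshift A) :=
  [set x | forall U, open U -> U x -> (0 < mu U)%E].

(* The finite word x_a x_(a+1) ... x_(b-1), for a <= b. *)
Definition subword x (a b : int) : seq A :=
  [seq x (a + k%:Z) | k <- iota 0 `|b - a|%N].

(* Bi-infinite concatenations; [c] lists the cutting positions. *)
Definition Xseq (G : set (seq A)) : set (fullshift A) :=
  [set x | exists c : int -> int, forall i : int,
    c i < c (i + 1) /\ G (subword x (c i) (c (i + 1)))].

Definition coded_shift (G : set (seq A)) : set (fullshift A) := closure (Xseq G).

Definition Xlim (G : set (seq A)) : set (fullshift A) :=
  coded_shift G `\` Xseq G.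

(* M_X, as measures on the full shift giving full mass to the closed set [X]. *)
Definition invariant_measures X : set (probability (fullshift A) R) :=
  [set mu | invariant_measure left_shift mu /\ mu X = 1%E].

Definition periodic_point_measure mu : Prop :=
  exists (x : fullshift A) (n : nat),
    [/\ (0 < n)%N, iter n left_shift x = x,
        forall m, (0 < m < n)%N -> iter m left_shift x <> x &
        forall B, measurable B ->
          mu B = ((n%:R^-1)%:E * \sum_(i < n) \d_(iter i left_shift x) B)%E].

(* C(X,R): functions are total, but their values off [X] are ignored by all the
   notions below, in particular by the topology of uniform convergence on [X]. *)
Definition continuous_functions X : set {uniform` X -> R} :=
  [set phi | {within X, continuous phi}].
Arguments continuous_functions X : clear implicits.

Definition measure_pressure X phi mu : \bar R :=
  (entropy left_shift mu + \int[mu]_(x in X) (phi x)%:E)%E.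

Definition Ptop X phi : \bar R :=
  ereal_sup [set measure_pressure X phi mu | mu in invariant_measures X].

Definition Pseq (G : set (seq A)) phi : \bar R :=
  ereal_sup [set measure_pressure (coded_shift G) phi mu | mu in
    [set mu | invariant_measures (coded_shift G) mu /\ carried_by mu (Xseq G)]].

Definition Plim (G : set (seq A)) phi : \bar R :=
  ereal_sup [set measure_pressure (coded_shift G) phi mu | mu in
    [set mu | invariant_measures (coded_shift G) mu /\ carried_by mu (Xlim G)]].

(* The closure is taken in [continuous_functions (coded_shift G)]. *)
Definition FSSP (G : set (seq A)) : set {uniform` (coded_shift G) -> R} :=
  continuous_functions (coded_shift G) `&`
  closure [set phi | continuous_functions (coded_shift G) phi /\
                     (Plim G phi < Pseq G phi)%E].

End shift_space.

Arguments invariant_measures R {A} X.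
Arguments continuous_functions R {A} X.
Arguments FSSP R {A} G.

(* Main.v *)
(* Let [phi] be continuous with [P_seq(phi) <= P_lim(phi)].  Every invariant [mu]
   splits into an invariant part carried by [X_seq] and one carried by [X_lim], and
   the pressure of [mu] is at most the corresponding convex combination, so
   [P_top(phi) = P_lim(phi)].  Since measures carried by [X_lim] have zero entropy,
   this number is finite.  Pick a periodic point measure [mu_k], separated from the
   supports of all measures carried by [X_lim], whose pressure exceeds
   [P_top(phi) - e]; adding to [phi] the function [e 1_N], where [N] is a small
   clopen neighbourhood of the support of [mu_k], raises the pressure of [mu_k]
   above [P_top(phi)] and leaves the pressure of measures on [X_lim] unchanged.
   The splitting needs [X_seq], which in general is analytic but not Borel, to be
   measurable for the completion of [mu]. *)
Require Import Defs.
From mathcomp Require Import all_boot all_order all_algebra.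
From mathcomp Require Import all_classical all_reals all_analysis.
From mathcomp Require Import measurable_realfun zify ring lra.
Import Order.TTheory GRing.Theory Num.Theory.
Import numFieldNormedType.Exports.
Local Open Scope classical_set_scope.
Local Open Scope ring_scope.

Set Implicit Arguments.
Unset Strict Implicit.
Unset Printing Implicit Defensive.

(** * Souslin sets *)

(** Intersecting a minimizing sequence of measurable supersets of [E] gives a set [B] of least
    measure among them. As [B] intersected with [C] is again a measurable superset, it has the same
    measure as [B]. *)
Lemma measurable_hull d (T : measurableType d) (R : realType)
    (mu : {finite_measure set T -> \bar R}) (E : set T) :
  exists B, [/\ measurable B, E `<=` B &
    forall C, measurable C -> E `<=` C -> mu (B `\` C) = 0%E].
Proof.
pose S := [set mu B | B in [set B | measurable B /\ E `<=` B]].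
have S0 : S != set0 by apply/set0P; exists (mu setT), setT.
have [u uS ucvg] := ereal_inf_seq S0.
have /choice[B Bu] : forall n, exists B, [/\ measurable B, E `<=` B & mu B = u n].
  by move=> n; have [B [mB EB] <-] := uS n; exists B.
have mB n : measurable (B n) by have [] := Bu n.
have EB n : E `<=` B n by have [] := Bu n.
have mI : measurable (\bigcap_n B n) by exact: bigcapT_measurable.
have finmu C : measurable C -> mu C \is a fin_num.
  by move=> mC; exact: fin_num_measure.
have le_inf C : measurable C -> E `<=` C -> (mu (\bigcap_n B n) <= mu C)%E.
  move=> mC EC; apply: (@le_trans _ _ (ereal_inf S)); last first.
    by apply: ereal_inf_lbound; exists C.
  apply: (cvge_ge _ ucvg); apply: nearW => n; have [_ _ <-] := Bu n.
  by apply: le_measure; rewrite ?inE//; exact: bigcap_inf.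
exists (\bigcap_n B n); split => //.
  by move=> x Ex n _; exact: EB.
move=> C mC EC; have mBC : measurable (\bigcap_n B n `&` C) by exact: measurableI.
have := le_inf _ mBC; rewrite measureD//; last first.
  by rewrite ltey_eq finmu.
move=> H; apply/eqP; rewrite eq_le sube_le0 H ?sube_ge0 ?finmu//=.
  by apply: le_measure; rewrite ?inE//; exact: subIsetl.
by move=> x Ex; split; [move=> n _; exact: EB|exact: EC].
Qed.

(* With [A t] the points admitting a witness [c] that starts with [t] and [B t] a
   measurable hull of [A t], the sets [B t `\` \bigcup_k B (rcons t k)] are null;
   outside of them, a point of [B [::]] admits a witness built step by step. *)
Lemma souslin_measurable d (T : measurableType d) (R : realType)
    (mu : {finite_measure set T -> \bar R}) (D : countType) (d0 : D)
    (P : nat -> (nat -> D) -> set T) :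
  (forall n c, measurable (P n c)) ->
  (forall n c c', (forall i, (i < n)%N -> c i = c' i) -> P n c = P n c') ->
  exists B, [/\ measurable B, \bigcup_c \bigcap_n P n c `<=` B &
    mu.-negligible (B `\` \bigcup_c \bigcap_n P n c)].
Proof.
move=> mP Pfin.
pose A (t : seq D) := [set x | exists c, (forall i, (i < size t)%N -> c i = nth d0 t i)
  /\ forall n, P n c x].
have /choice[H HP] t := measurable_hull mu (A t).
(* Besides the hull, [B t] records the condition at level [size t], which is already decided by
   [t]. *)
pose B t := H t `&` P (size t) (nth d0 t).
have mB t : measurable (B t) by apply: measurableI => //; have [] := HP t.
have AB t : A t `<=` B t.
  move=> x Ax; split; first by have [_ + _] := HP t; exact.
  by have [c [ct Pc]] := Ax; rewrite -(Pfin _ c).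
have AU t : A t `<=` \bigcup_k B (rcons t k).
  move=> x [c [ct Pc]]; exists (c (size t)) => //; apply: AB; exists c; split=> //.
  move=> i; rewrite size_rcons nth_rcons ltnS leq_eqVlt => /predU1P[->|it].
    by rewrite ltnn eqxx.
  by rewrite it ct.
have mU t : measurable (\bigcup_k B (rcons t k)).
  by apply: countable_bigcupT_measurable => //; exact: countableP.
pose N t := H t `\` \bigcup_k B (rcons t k).
have N0 : mu.-negligible (\bigcup_t N t).
  (* Finite sequences over [D] are countable; [pickle] turns the union over them into a union over
     natural numbers. *)
  pose F n := if @unpickle (seq D) n is Some t then N t else set0.
  apply: (@negligibleS _ _ _ _ (\bigcup_n F n)).
    by move=> x [t _ Nx]; exists (pickle t) => //; rewrite /F pickleK.
  apply: negligible_bigcup => n; rewrite /F; case: unpickle => [t|]; last first.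
    exact: negligible_set0.
  apply/negligibleP; first by apply: measurableD => //; have [] := HP t.
  by have [_ _] := HP t; apply.
exists (B [::]); split => //.
  by move=> x [c _ Pc]; apply: AB; exists c; split => // n; exact: Pc.
apply: (negligibleS _ N0) => x [Bx nAx]; apply: contrapT => nNx; apply: nAx.
have next t : B t x -> exists k, B (rcons t k) x.
  move=> Btx; apply: contrapT => nex; apply: nNx; exists t => //.
  by split; [case: Btx|move=> [k _ Bk]; apply: nex; exists k].
have /choice[g gP] t : exists k, B t x -> B (rcons t k) x.
  have [/next[k]|nB] := pselect (B t x); first by exists k.
  by exists d0 => /nB.
(* [s n] is the branch of length [n] grown by [g]. The infinite branch is the required witness:
   [P n] sees only its first [n] terms, which are those of [s n]. *)
pose s n := iter n (fun t => rcons t (g t)) [::].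
have Bs n : B (s n) x by elim: n => //= n; exact: gP.
have size_s n : size (s n) = n by elim: n => //= n IH; rewrite size_rcons IH.
have nth_s n i : (i < n)%N -> nth d0 (s n) i = g (s i).
  elim: n => // n IH; rewrite ltnS leq_eqVlt /= nth_rcons size_s.
  by move=> /predU1P[->|lt_in]; rewrite ?ltnn ?eqxx// lt_in IH.
exists (fun i => g (s i)) => // n _.
have [_] := Bs n; rewrite size_s (Pfin _ _ (fun i => g (s i)))//.
exact: nth_s.
Qed.

(** * Entropy of partitions *)

(** Fekete's lemma; the limit is the infimum of [a n / n] over positive [n]. Cutting [n] into blocks
    of an almost optimal length [N.+1] bounds [a n] by the number of blocks times [a N.+1], up to a
    constant. *)
Lemma fekete (R : realType) (a : nat -> R) :
  (forall n, 0 <= a n) -> (forall m n, a (m + n)%N <= a m + a n) ->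
  cvgn (fun n => n%:R^-1 * a n).
Proof.
move=> a0 aD.
pose S := [set n.+1%:R^-1 * a n.+1 | n in [set: nat]].
have S_inf : has_inf S.
  split; first by exists (1%:R^-1 * a 1%N), 0%N.
  by exists 0 => _ [n _ <-]; rewrite mulr_ge0.
apply/cvg_ex; exists (inf S); apply/cvgrPdist_le => e e0.
have e20 : 0 < e / 2 by rewrite divr_gt0.
have [_ [N _ <-] ltN] := inf_adherent e20 S_inf.
(* [C] bounds [a r] for all remainders [r] modulo [N.+1] at once. *)
pose C := \sum_(r < N.+1) a r.
have C0 : 0 <= C by apply: sumr_ge0.
(* The summand [a 0] covers the case [q = 0], since [a 0] may be positive. *)
have aqN q : a (q * N.+1)%N <= q%:R * a N.+1 + a 0%N.
  elim: q => [|q IH]; first by rewrite mul0n mul0r add0r.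
  rewrite mulSn; apply: le_trans (aD _ _) _.
  by rewrite -natr1 mulrDl mul1r; lra.
have a_le n : a n <= (n %/ N.+1)%:R * a N.+1 + a 0%N + C.
  rewrite {1}(divn_eq n N.+1); apply: le_trans (aD _ _) _; apply: lerD => //.
  pose r := Ordinal (ltn_pmod n (ltn0Sn N)).
  by rewrite /C (bigD1 r)//= lerDl; apply: sumr_ge0.
near=> n.
have n0 : (0 < n)%N by near: n; exact: nbhs_infty_gt.
have nR0 : 0 < n%:R :> R by rewrite ltr0n.
have inf_le : inf S <= n%:R^-1 * a n.
  by apply: ge_inf; [case: S_inf|exists n.-1; rewrite // prednK].
rewrite ler0_norm ?subr_le0// opprB.
(* For large [n] the constants cost at most [e / 2] after division by [n]; the other [e / 2] was
   spent on the choice of [N]. *)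
have Cn : (a 0%N + C) <= e / 2 * n%:R.
  rewrite mulrC -ler_pdivrMr//; apply: ltW.
  by near: n; exact: nbhs_infty_gtr.
suff : n%:R^-1 * a n <= N.+1%:R^-1 * a N.+1 + e / 2.
  rewrite lerBlDl => /le_trans; apply; rewrite -lerBrDr (le_trans (ltW ltN))//.
  by rewrite -addrA lerD2l; lra.
rewrite mulrC ler_pdivrMr// (le_trans (a_le n))// mulrDl -addrA lerD//.
rewrite mulrAC ler_wpM2r// mulrC ler_pdivlMr ?ltr0n// -natrM ler_nat.
exact: leq_trunc_div.
Unshelve. all: by end_near.
Qed.

(** * Inequalities for [x ln x] *)

Section finite_entropy.
Context {R : realType}.

Lemma ln_le_subr1 (x : R) : 0 < x -> ln x <= x - 1.
Proof.
move=> x0; have := @le_ln1Dx R (x - 1).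
by rewrite [1 + _]addrC subrK; apply; lra.
Qed.

(** Termwise, [ln x <= x - 1] at [x = q i / p i]. The third hypothesis excludes [q i = 0 < p i],
    where the convention [ln 0 = 0] would break the termwise bound. *)
Lemma gibbs (I : finType) (p q : I -> R) :
  (forall i, 0 <= p i) -> (forall i, 0 <= q i) ->
  (forall i, q i = 0 -> p i = 0) -> \sum_i q i <= \sum_i p i ->
  - \sum_i p i * ln (p i) <= - \sum_i p i * ln (q i).
Proof.
move=> p0 q0 pq0 sum_le; rewrite lerN2 -subr_ge0 -sumrB.
apply: (@le_trans _ _ (\sum_i (p i - q i))); first by rewrite sumrB subr_ge0.
apply: ler_sum => i _; have := p0 i; rewrite le_eqVlt => /predU1P[<-|pi0].
  by rewrite !mul0r !sub0r oppr0 oppr_le0.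
have qi0 : 0 < q i.
  by rewrite lt_neqAle q0 andbT eq_sym; apply/eqP => /pq0 E; rewrite E ltxx in pi0.
have := ln_le_subr1 (divr_gt0 qi0 pi0).
rewrite ln_div// => /(ler_wpM2l (p0 i)).
rewrite [p i * (_ / _ - 1)]mulrBr mulrCA divff ?gt_eqF// !mulr1 mulrBr; lra.
Qed.

(** By monotonicity, [ln (s * p + t * q)] may be replaced by [ln (s * p)] when weighted by [s * p],
    and by [ln (t * q)] when weighted by [t * q]; these logarithms then split. The last bracket is
    the defect of convexity. *)
Lemma xlnx_convex_defect (s t p q : R) : 0 <= s -> 0 <= t -> 0 <= p -> 0 <= q ->
  - ((s * p + t * q) * ln (s * p + t * q)) <=
  s * - (p * ln p) + t * - (q * ln q) + (p * - (s * ln s) + q * - (t * ln t)).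
Proof.
move=> s0 t0 p0 q0.
have H (a b : R) : 0 <= a -> 0 <= b -> a * ln a <= a * ln (a + b).
  move=> a0 b0; have := a0; rewrite le_eqVlt => /predU1P[<-|a_gt0].
    by rewrite !mul0r.
  by rewrite ler_pM2l// ler_ln ?posrE// ?ltr_wpDr// lerDl.
have HM (a b : R) : 0 <= a -> 0 <= b ->
    a * b * ln (a * b) = a * b * ln a + a * b * ln b.
  rewrite le_eqVlt => /predU1P[<-|a_gt0]; first by rewrite !mul0r addr0.
  rewrite le_eqVlt => /predU1P[<-|b_gt0]; first by rewrite !mulr0 !mul0r addr0.
  by rewrite lnM ?posrE// mulrDr.
have := H (s * p) (t * q) (mulr_ge0 s0 p0) (mulr_ge0 t0 q0).
have := H (t * q) (s * p) (mulr_ge0 t0 q0) (mulr_ge0 s0 p0).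
rewrite [t * q + _]addrC !HM// !mulrDl; nra.
Qed.

End finite_entropy.

(** * Entropy of a measurable partition and its subadditivity along orbits *)

Section partition_entropy.
Context d (T : measurableType d) (R : realType).
Implicit Types (mu : probability T R).

Definition measurable_partition {I : finType} (xi : T -> I) :=
  forall i, measurable (xi @^-1` [set i]).

Lemma measurable_partition_set {I : finType} (xi : T -> I) (A : set I) :
  measurable_partition xi -> measurable (xi @^-1` A).
Proof.
move=> mxi; rewrite (_ : _ @^-1` _ = \bigcup_(i in A) xi @^-1` [set i]).
  by apply: fin_bigcup_measurable => //; exact: finite_finset.
by apply/seteqP; split => [x Ax|x [i Ai /= ->]//]; exists (xi x).
Qed.

Lemma measurable_partition_comp {I J : finType} (xi : T -> I) (g : I -> J) :
  measurable_partition xi -> measurable_partition (g \o xi).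
Proof.
by move=> mxi j; rewrite comp_preimage; exact: measurable_partition_set.
Qed.

Lemma measurable_partition_pair (I J : finType) (xi : T -> I) (eta : T -> J) :
  measurable_partition xi -> measurable_partition eta ->
  measurable_partition (fun x => (xi x, eta x)).
Proof.
move=> mxi meta [i j].
rewrite (_ : _ @^-1` _ = xi @^-1` [set i] `&` eta @^-1` [set j]).
  exact: measurableI.
by apply/seteqP; split => [x [<- <-]//|x /= [-> ->]].
Qed.

Lemma measure_partition_sum mu {I : finType} (xi : T -> I) (E : set T) :
  measurable_partition xi -> measurable E ->
  fine (mu E) = \sum_(i : I) fine (mu (E `&` xi @^-1` [set i])).
Proof.
move=> mxi mE; rewrite sum_fine; last first.
  by move=> i _; apply: fin_num_measure; exact: measurableI.
rewrite (big_enum_val (A := I)) -(@measure_bigsetU_ord _ _ _ mu _ xpredT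
  (fun k => E `&` xi @^-1` [set enum_val k])).
- congr (fine (mu _)); rewrite -bigcup_seq -setI_bigcupr; apply/esym/setIidl.
  move=> x _; exists (enum_rank (xi x)); first by rewrite /= mem_index_enum.
  by rewrite /= enum_rankK.
- by move=> i; exact: measurableI.
- move=> i j _ _ [x [[_ /= xi_i] [_ /= xi_j]]].
  by apply: enum_val_inj; rewrite -xi_i -xi_j.
Qed.

Section entropy_inequalities.
Variables (mu : probability T R).
Local Notation p xi i := (fine (mu (xi @^-1` [set i]))).

Lemma fine_measure_ge0 (E : set T) : 0 <= fine (mu E).
Proof. by rewrite fine_ge0. Qed.

Lemma fine_measureS (E F : set T) :
  measurable E -> measurable F -> E `<=` F -> fine (mu E) <= fine (mu F).
Proof.
by move=> mE mF EF; rewrite fine_le ?fin_num_measure// le_measure ?inE.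
Qed.

Lemma sum_partition1 (I : finType) (xi : T -> I) :
  measurable_partition xi -> \sum_i p xi i = 1.
Proof.
move=> mxi; have := measure_partition_sum mu mxi measurableT.
rewrite probability_setT /= => ->.
by apply: eq_bigr => i _; rewrite setTI.
Qed.

Lemma partition_entropy_ge0 (I : finType) (xi : T -> I) :
  measurable_partition xi -> 0 <= partition_entropy mu xi.
Proof.
move=> mxi; rewrite /partition_entropy oppr_ge0; apply: sumr_le0 => i _.
rewrite mulr_ge0_le0 ?fine_measure_ge0// ln_le0//.
have := fine_measureS (mxi i) measurableT (@subsetT _ _).
by rewrite probability_setT.
Qed.

(** Each cell of [xi] lies in a cell of the coarser partition [h \o xi], so grouping the cells by
    the fibres of [h] reduces the bound to monotonicity of [ln]. *)
Lemma partition_entropy_comp (I J : finType) (xi : T -> J) (h : J -> I) :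
  measurable_partition xi ->
  partition_entropy mu (h \o xi) <= partition_entropy mu xi.
Proof.
move=> mxi; have mhxi := measurable_partition_comp h mxi.
rewrite lerN2 [leRHS](eq_bigr (fun i =>
    \sum_(j | h j == i) p xi j * ln (p (h \o xi) (h j)))); last first.
  move=> i _; rewrite [X in X * _](measure_partition_sum mu mxi)// mulr_suml.
  rewrite [RHS]big_mkcond/=; apply: eq_bigr => j _; case: eqP => [<-|hji].
    by congr (fine (mu _) * _); apply/seteqP; split => [x []//|x /= <-].
  rewrite (_ : _ `&` _ = set0) ?measure0 ?mul0r//.
  by rewrite -subset0 => x [/= hx xj]; apply: hji; rewrite -xj.
rewrite [leLHS](partition_big h xpredT)//=;
apply: ler_sum => i _; apply: ler_sum => j _.
have := fine_measure_ge0 (xi @^-1` [set j]); rewrite le_eqVlt => /predU1P[<-|pj0].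
  by rewrite !mul0r.
rewrite ler_pM2l// ler_ln ?posrE//; last apply: lt_le_trans pj0 _.
  1,2: by apply: fine_measureS => // x /= ->.
Qed.

(** [gibbs] compares the joint distribution with the product of its marginals. The logarithm of the
    product splits, and summing out one coordinate leaves the two entropies. *)
Lemma partition_entropy_pair (I J : finType) (xi : T -> I) (eta : T -> J) :
  measurable_partition xi -> measurable_partition eta ->
  partition_entropy mu (fun x => (xi x, eta x)) <=
  partition_entropy mu xi + partition_entropy mu eta.
Proof.
move=> mxi meta.
set zeta := fun x => (xi x, eta x).
have zetaE i j : zeta @^-1` [set (i, j)] = xi @^-1` [set i] `&` eta @^-1` [set j].
  by apply/seteqP; split => [x [<- <-]//|x [/= xi_i eta_j]]; rewrite /zeta xi_i eta_j.
have mzeta := measurable_partition_pair mxi meta.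
have pxi k : p zeta k <= p xi k.1.
  by apply: fine_measureS => // x /= <-.
have peta k : p zeta k <= p eta k.2.
  by apply: fine_measureS => // x /= <-.
apply: (@le_trans _ _ (- \sum_k p zeta k * ln (p xi k.1 * p eta k.2))).
  apply: gibbs => [k|k|k /eqP|].
  - exact: fine_measure_ge0.
  - by rewrite mulr_ge0 ?fine_measure_ge0.
  - rewrite mulf_eq0 => /orP[] /eqP E; apply/eqP; rewrite eq_le fine_measure_ge0.
      by rewrite -E pxi.
    by rewrite -E peta.
  - rewrite sum_partition1//.
    rewrite -(pair_bigA _ (fun i j => p xi i * p eta j))/=.
    under eq_bigr do rewrite -mulr_sumr sum_partition1// mulr1.
    by rewrite sum_partition1.
rewrite -opprD lerN2.
rewrite (eq_bigr (fun k => p zeta k * ln (p xi k.1) + p zeta k * ln (p eta k.2))).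
  rewrite big_split/=; apply: lerD.
    rewrite [leRHS](eq_bigr (fun k => p zeta (k.1, k.2) * ln (p xi k.1)));
      last by case.
    rewrite -(pair_bigA _ (fun i j => p zeta (i, j) * ln (p xi i)))/=.
    apply: ler_sum => i _; rewrite -mulr_suml (measure_partition_sum mu meta)//.
    by under [in leRHS]eq_bigr do rewrite zetaE.
  rewrite [leRHS](eq_bigr (fun k => p zeta (k.1, k.2) * ln (p eta k.2)));
    last by case.
  rewrite -(pair_bigA _ (fun i j => p zeta (i, j) * ln (p eta j)))/=.
  rewrite exchange_big/=; apply: ler_sum => j _.
  rewrite -mulr_suml (measure_partition_sum mu mxi)//.
  by under [in leRHS]eq_bigr do rewrite zetaE setIC.
move=> k _; have := fine_measure_ge0 (zeta @^-1` [set k]).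
rewrite le_eqVlt => /predU1P[<-|pk0]; first by rewrite !mul0r addr0.
by rewrite lnM ?mulrDr// posrE; exact: lt_le_trans pk0 _.
Qed.

Variable f : T -> T.
Hypothesis mf : measurable_fun setT f.
Hypothesis f_inv : invariant_measure f mu.

Lemma measurable_partition_iter (I : finType) (xi : T -> I) n :
  measurable_partition xi -> measurable_partition (xi \o iter n f).
Proof.
move=> mxi; elim: n => // n IH i.
have -> : xi \o iter n.+1 f = (xi \o iter n f) \o f.
  by apply/funext => x /=; rewrite -iterS iterSr.
by rewrite comp_preimage -[X in measurable X]setTI; exact: mf.
Qed.

Lemma partition_entropy_iter (I : finType) (xi : T -> I) n :
  measurable_partition xi ->
  partition_entropy mu (xi \o iter n f) = partition_entropy mu xi.
Proof.
move=> mxi; elim: n => // n <-; congr (- _); apply: eq_bigr => i _.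
have -> : xi \o iter n.+1 f = (xi \o iter n f) \o f.
  by apply/funext => x /=; rewrite -iterS iterSr.
by rewrite [in LHS]comp_preimage f_inv//; exact: measurable_partition_iter.
Qed.

Lemma measurable_iterated_partition (I : finType) (xi : T -> I) n :
  measurable_partition xi -> measurable_partition (iterated_partition f n xi).
Proof.
move=> mxi u; rewrite (_ : _ @^-1` _ =
    \bigcap_(j in [set: 'I_n]) (xi \o iter j f) @^-1` [set u j]).
  apply: fin_bigcap_measurable => [|j _]; first exact: finite_finset.
  exact: measurable_partition_iter.
apply/seteqP; split => [x /= <- j _|x H]; first by rewrite /= ffunE.
by apply/ffunP => j; rewrite ffunE; exact: H.
Qed.

Lemma partition_entropy_subadditive (I : finType) (xi : T -> I) m n :
  measurable_partition xi ->
  partition_entropy mu (iterated_partition f (m + n) xi) <=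
  partition_entropy mu (iterated_partition f m xi) +
  partition_entropy mu (iterated_partition f n xi).
Proof.
move=> mxi; have mit k := measurable_iterated_partition (n := k) mxi.
rewrite -(partition_entropy_iter m (mit n)).
apply: le_trans (partition_entropy_pair (mit m)
  (measurable_partition_iter m (mit n))).
(* [h] glues the itinerary of [x] of length [m] to that of its [m]-th iterate of length [n]; the
   partition of length [m + n] is thus a function of the pair. *)
pose h (uv : {ffun 'I_m -> I} * {ffun 'I_n -> I}) : {ffun 'I_(m + n) -> I} :=
  [ffun k => match fintype.split k with inl i => uv.1 i | inr j => uv.2 j end].
rewrite (_ : iterated_partition f (m + n) xi = h \o (fun x =>
    (iterated_partition f m xi x, (iterated_partition f n xi \o iter m f) x))).
  apply/partition_entropy_comp/measurable_partition_pair => //.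
  exact: measurable_partition_iter.
apply/funext => x; apply/ffunP => k; rewrite !ffunE/=.
case: splitP => j kj; rewrite ffunE kj//.
by rewrite addnC iterD.
Qed.

(** This makes the [limn] in [entropy_of_partition] a genuine limit, so that bounds at each [n] pass
    to it. *)
Lemma cvg_entropy_of_partition (I : finType) (xi : T -> I) :
  measurable_partition xi ->
  cvgn (fun n => n%:R^-1 * partition_entropy mu (iterated_partition f n xi)).
Proof.
move=> mxi; apply: fekete => [n|m n]; last exact: partition_entropy_subadditive.
exact/partition_entropy_ge0/measurable_iterated_partition.
Qed.

End entropy_inequalities.

End partition_entropy.

(** * Entropy of a convex combination of invariant measures *)

Section entropy_mixture.
Context d (T : measurableType d) (R : realType) (f : T -> T).
Hypothesis mf : measurable_fun setT f.
Implicit Types (mu : probability T R).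

(** The one-cell partition competes in the supremum. *)
Lemma entropy_ge0 mu : invariant_measure f mu -> (0 <= entropy f mu)%E.
Proof.
move=> f_inv; pose xi : T -> 'I_1 := fun=> ord0.
have mxi : measurable_partition xi.
  by move=> i; rewrite preimage_cst; case: ifP.
apply: (@le_trans _ _ (entropy_of_partition f mu xi)%:E); last first.
  by apply: ereal_sup_ubound; exists 1%N, xi.
rewrite lee_fin; apply: limr_ge; first exact: cvg_entropy_of_partition.
apply: nearW => n; rewrite mulr_ge0//.
exact/partition_entropy_ge0/measurable_iterated_partition.
Qed.

Variables (s t : R) (mu mu1 mu2 : probability T R).
Hypotheses (s0 : 0 <= s) (t0 : 0 <= t).
Hypothesis mix : forall E, measurable E ->
  fine (mu E) = s * fine (mu1 E) + t * fine (mu2 E).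
Hypothesis f_inv : invariant_measure f mu.
Hypothesis f_inv1 : invariant_measure f mu1.
Hypothesis f_inv2 : invariant_measure f mu2.

Lemma partition_entropy_mix (I : finType) (xi : T -> I) :
  measurable_partition xi ->
  partition_entropy mu xi <=
  s * partition_entropy mu1 xi + t * partition_entropy mu2 xi -
  (s * ln s + t * ln t).
Proof.
move=> mxi; rewrite /partition_entropy opprD.
(* The constants are multiplied by the total masses, written as sums over cells, so that the
   inequality can be checked cell by cell. *)
rewrite -[- (s * ln s)]mul1r -(sum_partition1 mu1 mxi).
rewrite -[- (t * ln t)]mul1r -(sum_partition1 mu2 mxi).
rewrite -!sumrN !mulr_sumr !mulr_suml -!big_split/=.
apply: ler_sum => i _; rewrite mix//.
by apply: xlnx_convex_defect; rewrite ?fine_measure_ge0.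
Qed.

(** The defect in [partition_entropy_mix] is the same for all partitions, hence independent of [n];
    it vanishes after division by [n]. *)
Lemma entropy_of_partition_mix (I : finType) (xi : T -> I) :
  measurable_partition xi ->
  entropy_of_partition f mu xi <=
  s * entropy_of_partition f mu1 xi + t * entropy_of_partition f mu2 xi.
Proof.
move=> mxi.
pose C := - (s * ln s + t * ln t).
have cV : (fun n : nat => n%:R^-1 : R) @ \oo --> (0 : R).
  apply/gtr0_cvgV0; last exact: cvgr_idn.
  by near=> n; rewrite ltr0n; near: n; exact: nbhs_infty_gt.
have c1 := cvg_entropy_of_partition mf f_inv1 mxi.
have c2 := cvg_entropy_of_partition mf f_inv2 mxi.
pose g n := s * (n%:R^-1 * partition_entropy mu1 (iterated_partition f n xi)) +
  t * (n%:R^-1 * partition_entropy mu2 (iterated_partition f n xi)) + n%:R^-1 * C.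
have cg : g @ \oo --> s * entropy_of_partition f mu1 xi +
    t * entropy_of_partition f mu2 xi + 0 * C.
  apply: cvgD; last exact: cvgMr_tmp.
  by apply: cvgD; apply: cvgMl_tmp.
rewrite mul0r addr0 in cg.
apply: (ler_cvg_to (cvg_entropy_of_partition mf f_inv mxi) cg).
apply: nearW => n; rewrite /g mulrCA [t * (_ * _)]mulrCA -!mulrDr ler_wpM2l//.
exact/partition_entropy_mix/measurable_iterated_partition.
Unshelve. all: by end_near.
Qed.

Lemma entropy_mix :
  (entropy f mu <= s%:E * entropy f mu1 + t%:E * entropy f mu2)%E.
Proof.
apply: ub_ereal_sup => _ [k [xi [mxi ->]]].
apply: (@le_trans _ _ (s%:E * (entropy_of_partition f mu1 xi)%:E +
    t%:E * (entropy_of_partition f mu2 xi)%:E)%E).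
  by rewrite -!EFinM -EFinD lee_fin; exact: entropy_of_partition_mix.
by apply: leeD; apply: lee_wpmul2l; rewrite ?lee_fin//; apply: ereal_sup_ubound;
  exists k, xi.
Qed.

End entropy_mixture.

(** * Conditional measures *)

Section conditional_measure.
Context d (T : measurableType d) (R : realType).
Variables (mu : probability T R).

(* This is [mu] itself when [mu B = 0]. *)
Definition conditional_measure (B : set T) (mB : measurable B) :
    probability T R :=
  mnormalize (mrestr mu mB) mu.

Lemma conditional_measureE (B : set T) (mB : measurable B) E : mu B != 0%E ->
  conditional_measure mB E = (mu (E `&` B) * (fine (mu B))^-1%:E)%E.
Proof.
move=> B0 /=; rewrite /mnormalize /= /mrestr setTI (negbTE B0)/=.
by rewrite (negbTE (_ : mu B != +oo%E))// -ltey ltey_eq fin_num_measure.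
Qed.

Lemma conditional_measure_mix (B : set T) (mB : measurable B)
    (mBC : measurable (~` B)) E :
  mu B != 0%E -> mu (~` B) != 0%E -> measurable E ->
  fine (mu E) = fine (mu B) * fine (conditional_measure mB E) +
                fine (mu (~` B)) * fine (conditional_measure mBC E).
Proof.
move=> B0 BC0 mE; rewrite !conditional_measureE//.
have mI : measurable (E `&` B) by exact: measurableI.
have mIC : measurable (E `&` ~` B) by exact: measurableI.
rewrite !fineM ?fin_num_measure//=.
rewrite ![_ * (_ * _)]mulrC -!mulrA !mulVf ?mulr1; first last.
- by rewrite fine_eq0 ?fin_num_measure.
- by rewrite fine_eq0 ?fin_num_measure.
rewrite -fineD ?fin_num_measure//; congr fine.
by rewrite (measureDI mu mE mB) setDE addeC.
Qed.

Lemma eq_measure_mod_null P Q : measurable P -> measurable Q ->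
  mu (P `\` Q) = 0%E -> mu (Q `\` P) = 0%E -> mu P = mu Q.
Proof.
move=> mP mQ PQ QP.
have -> : mu P = (mu (P `\` Q) + mu (P `&` Q))%E by exact: measureDI.
have -> : mu Q = (mu (Q `\` P) + mu (Q `&` P))%E by exact: measureDI.
by rewrite PQ QP setIC.
Qed.

Variables (f : T -> T) (mf : measurable_fun setT f).
Hypothesis f_inv : invariant_measure f mu.

Lemma measurable_preimage B : measurable B -> measurable (f @^-1` B).
Proof. by move=> mB; rewrite -[X in measurable X]setTI; exact: mf. Qed.

(** [B] and its preimage have the same finite measure, so their two differences have equal measure:
    one inclusion modulo null sets yields the other. *)
Lemma preimage_setD_null B : measurable B -> mu (B `\` f @^-1` B) = 0%E ->
  mu (f @^-1` B `\` B) = 0%E.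
Proof.
move=> mB BfB; have mfB := measurable_preimage mB.
have := f_inv mB.
have -> : mu (f @^-1` B) = (mu (f @^-1` B `\` B) + mu (f @^-1` B `&` B))%E.
  exact: measureDI.
have -> : mu B = (mu (B `\` f @^-1` B) + mu (B `&` f @^-1` B))%E.
  exact: measureDI.
rewrite BfB add0e setIC.
have mI : measurable (B `&` f @^-1` B) by exact: measurableI.
have mD : measurable (f @^-1` B `\` B) by exact: measurableD.
move=> /(congr1 fine); rewrite fineD ?fin_num_measure//.
rewrite -[RHS]add0r => /addIr E.
by rewrite -(fineK (fin_num_measure mu _ mD)) E.
Qed.

(** Since [B] is invariant modulo null sets, the preimage of the intersection of [E] and [B] agrees
    up to a null set with the intersection of [B] and the preimage of [E]. *)
Lemma conditional_measure_invariant B (mB : measurable B) :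
  mu B != 0%E -> mu (B `\` f @^-1` B) = 0%E ->
  invariant_measure f (conditional_measure mB).
Proof.
move=> B0 BfB E mE; rewrite !conditional_measureE//; congr (_ * _)%E.
have fBB := preimage_setD_null mB BfB.
have mfB := measurable_preimage mB; have mfE := measurable_preimage mE.
rewrite -(f_inv (measurableI _ _ mE mB)) preimage_setI.
apply: eq_measure_mod_null; try exact: measurableI.
  apply/(negligibleP mu); first by apply: measurableD; exact: measurableI.
  apply: (@negligibleS _ _ _ mu (B `\` f @^-1` B)).
    by move=> x [[Ex Bx] nfx]; split => // fBx; apply: nfx.
  by apply/negligibleP => //; exact: measurableD.
apply/(negligibleP mu); first by apply: measurableD; exact: measurableI.
apply: (@negligibleS _ _ _ mu (f @^-1` B `\` B)).
  by move=> x [[Ex Bx] nfx]; split => // fBx; apply: nfx.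
by apply/negligibleP => //; exact: measurableD.
Qed.

Lemma negligible_conditional B (mB : measurable B) N :
  mu B != 0%E -> mu.-negligible (N `&` B) ->
  (conditional_measure mB).-negligible N.
Proof.
move=> B0 [C [mC C0 NBC]]; exists (C `|` ~` B); split.
- by apply: measurableU => //; exact: measurableC.
- rewrite conditional_measureE// setIUl setICl setU0.
  rewrite (_ : mu (C `&` B) = 0%E) ?mul0e//; apply/eqP.
  by rewrite -measure_le0 -C0 le_measure ?inE//; exact: measurableI.
- by move=> x Nx; have [Bx|nBx] := pselect (B x); [left; exact: NBC|right].
Qed.

End conditional_measure.

(** * The shift space *)

Section shift_topology.
Variable A : alphabetType.
Implicit Types (x y : fullshift A) (U : set (fullshift A)).

Lemma nbhs_window n x : nbhs x [set y | forall k : int, (`|k| <= n)%N -> y k = x k].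
Proof.
have agree (k : int) : nbhs x [set y : fullshift A | y k = x k].
  apply: (@proj_continuous int (fun=> discrete_topology A) k x [set x k]).
  exact: discrete_set1.
have : nbhs x [set y : fullshift A |
    forall i : 'I_(n.+1), y i%:Z = x i%:Z /\ y (- i%:Z) = x (- i%:Z)].
  by apply: (@filter_forall _ _ _ (nbhs x)) => i; apply: filterI; exact: agree.
apply: filterS => y /= yx k kn; have := yx (Ordinal (kn : (`|k| < n.+1)%N)).
by case=> /= yk yNk; case: (intP k) yk yNk => [|m|m] //=; rewrite ?opprK.
Qed.

Lemma open_window n U :
  (forall x y, (forall k : int, (`|k| <= n)%N -> y k = x k) -> U x -> U y) ->
  open U.
Proof.
move=> Uloc; rewrite openE => x Ux; apply: filterS (nbhs_window n x) => y yx.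
exact: Uloc Ux.
Qed.

Lemma open_measurable_shift U : open U -> measurable U.
Proof. exact: sub_sigma_algebra. Qed.

Lemma closed_measurable_shift U : closed U -> measurable U.
Proof.
move=> cU; rewrite -[U]setCK; apply: measurableC.
by apply: open_measurable_shift; exact: closed_openC.
Qed.

Lemma compact_fullshift : compact [set: fullshift A].
Proof.
have := @tychonoff int (fun=> discrete_topology A) (fun=> setT).
rewrite (_ : [set f | _] = setT); last by apply/seteqP.
apply=> i; apply: finite_compact; exact: finite_finset.
Qed.

Lemma continuous_left_shift : continuous (@left_shift A).
Proof.
move=> x; have FF : Filter (@left_shift A @ x).
  exact: (fmap_filter _ (nbhs_filter x)).
suff : @left_shift A @ x -->
    (left_shift x : {ptws int -> discrete_topology A}) by [].
apply/cvg_sup => k V; rewrite nbhsE => -[B [[W _ <-] xW] WV].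
apply: filterS (nbhs_window `|k + 1| x) => y yx; apply: WV => /=.
by rewrite /left_shift yx.
Qed.

Lemma measurable_left_shift : measurable_fun setT (@left_shift A).
Proof.
apply: (@measurability _ _ _ _ _ _ (@open (fullshift A))) => // _ [U oU <-].
rewrite setTI; apply: open_measurable_shift.
by apply: open_comp => // x _; exact: continuous_left_shift.
Qed.

End shift_topology.

(** * Measurability and shift invariance of the set of concatenations *)

Section coded_shifts.
Variables (A : alphabetType) (G : set (seq A)).

Lemma measurable_coded_shift : measurable (coded_shift G).
Proof. by apply: closed_measurable_shift; exact: closed_closure. Qed.

Lemma Xseq_coded_shift : Xseq G `<=` coded_shift G.
Proof. exact: subset_closure. Qed.

(** Through [preimage_setD_null], this inclusion makes a measurable version of [Xseq G] invariant
    modulo null sets. *)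
Lemma Xseq_left_shift (x : fullshift A) : Xseq G x -> Xseq G (left_shift x).
Proof.
move=> [c cP]; exists (fun i => c i - 1) => i; have [lt_c Gc] := cP i.
split; first by lia.
rewrite (_ : subword _ _ _ = subword x (c i) (c (i + 1)))//.
rewrite /subword (_ : c (i + 1) - 1 - (c i - 1) = c (i + 1) - c i); last by lia.
by apply: eq_map => k; rewrite /left_shift; congr x; lia.
Qed.

Lemma measurable_cut (a b : int) :
  measurable [set x : fullshift A | a < b /\ G (subword x a b)].
Proof.
apply: open_measurable_shift.
(* This radius covers all the positions read by [subword x a b]. *)
apply: (@open_window _ (`|a| + `|b - a|)%N) => x y yx [ab Gx].
split=> //; rewrite (_ : subword y a b = subword x a b)//.
apply/eq_in_map => k; rewrite mem_iota => /andP[_ lt_k]; apply: yx; lia.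
Qed.

(** The integers are folded so that the cut of index [i] sits in the term of [c] of index [|i|]. A
    condition on finitely many cuts then involves only an initial segment of [c], as
    [souslin_measurable] requires. *)
Let cuts (c : nat -> int * int) (i : int) : int :=
  match i with Posz m => (c m).1 | Negz m => (c m.+1).2 end.

(** There are uncountably many cutting sequences, but their terms lie in a countable set, and each
    sequence imposes countably many measurable conditions: [Xseq G] is a Souslin set. *)
Lemma Xseq_measurable (R : realType) (mu : probability (fullshift A) R) :
  exists B, [/\ measurable B, Xseq G `<=` B & mu.-negligible (B `\` Xseq G)].
Proof.
pose cut c i : set (fullshift A) := [set x | cuts c i < cuts c (i + 1) /\
  G (subword x (cuts c i) (cuts c (i + 1)))].
(* The cut conditions at [m] and [- m.+1] involve the first [m.+2] terms of [c]. *)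
pose P n c := if n is m.+2 then cut c m%:Z `&` cut c (Negz m) else setT.
have cutsE c c' (i : int) : c `|i|%N = c' `|i|%N -> cuts c i = cuts c' i.
  by case: i => m /=; rewrite ?absz_nat /= => ->.
have [|n c c' cc'|] := @souslin_measurable _ _ _ mu (int * int)%type (0, 0) P.
- by case=> [|[|m]] c; rewrite /P//; apply: measurableI; exact: measurable_cut.
- case: n cc' => [|[|m]]// cc'; rewrite /P /cut.
  by rewrite !(cutsE c c')//; apply: cc'; lia.
rewrite (_ : \bigcup_c \bigcap_n P n c = Xseq G); first by move=> B; exists B.
apply/seteqP; split => x.
  move=> [c _ Pc]; exists (cuts c) => -[m|m]; first by have [] := Pc m.+2 I.
  by have [] := Pc m.+2 I.
move=> [c cP]; exists (fun m => (c m%:Z, c (- m%:Z))) => // n _.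
have cE i : cuts (fun m => (c m%:Z, c (- m%:Z))) i = c i.
  by case: i => m //=; rewrite NegzE.
case: n => [|[|m]]//; rewrite /P /cut /mkset; split; rewrite !cE; exact: cP.
Qed.

End coded_shifts.

(** * Pressure *)

Lemma integral_mixture d (T : measurableType d) (R : realType)
    (mu mu1 mu2 : {measure set T -> \bar R}) (s t : R) (D : set T)
    (g : T -> \bar R) :
  0 <= s -> 0 <= t -> measurable D ->
  (forall E, measurable E -> mu E = (s%:E * mu1 E + t%:E * mu2 E)%E) ->
  measurable_fun D g ->
  (forall x, D x -> (0 <= g x)%E) ->
  (\int[mu]_(x in D) g x =
   s%:E * \int[mu1]_(x in D) g x + t%:E * \int[mu2]_(x in D) g x)%E.
Proof.
move=> s0 t0 mD mix mg g0.
rewrite -(ge0_integral_mscale mu1 mD (NngNum s0))//.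
rewrite -(ge0_integral_mscale mu2 mD (NngNum t0))//.
rewrite -ge0_integral_measure_add//.
apply: eq_measure_integral => E mE _.
apply: etrans (mix _ mE) _.
by rewrite /= /msum /= !big_ord_recl big_ord0 adde0 /= /mscale.
Qed.

(** * Integrals of continuous potentials *)

Section continuous_on_coded_shift.
Variables (R : realType) (A : alphabetType) (G : set (seq A)).
Variable phi : fullshift A -> R.
Hypothesis cphi : {within coded_shift G, continuous phi}.
Local Notation X := (coded_shift G).

Lemma continuous_bounded_coded_shift :
  exists M : R, forall x, X x -> `|phi x| <= M.
Proof.
have cX : compact X.
  by apply: (subclosed_compact _ (@compact_fullshift A)) => //; exact: closed_closure.
have [M [_ MP]] := compact_bounded (continuous_compact cphi cX).
exists (M + 1) => x Xx; apply: (MP (M + 1)); first by rewrite ltrDl.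
by exists x.
Qed.

Lemma continuous_measurable_coded_shift : measurable_fun X phi.
Proof.
apply: (measurability _ (RGenOpens.measurableE R)) => _ [_ [a [b ->] <-]].
have /continuousP co := cphi.
have /open_subspaceP[V oV VE] : open (phi @^-1` `]a, b[ : set (subspace X)).
  by apply: co; exact: interval_open.
rewrite setIC -VE; apply: measurableI; last exact: measurable_coded_shift.
exact: open_measurable_shift.
Qed.

Implicit Types mu : probability (fullshift A) R.

Lemma integrable_coded_shift mu : mu.-integrable X (EFin \o phi).
Proof.
have [M MP] := continuous_bounded_coded_shift.
apply: measurable_bounded_integrable.
- exact: measurable_coded_shift.
- by rewrite ltey_eq fin_num_measure//; exact: measurable_coded_shift.
- exact: continuous_measurable_coded_shift.
- exists M; split; first exact: num_real.
  by move=> K MK x Xx; exact: le_trans (MP _ Xx) (ltW MK).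
Qed.

Lemma integral_fin_num_coded_shift mu :
  (\int[mu]_(x in X) (phi x)%:E)%E \is a fin_num.
Proof.
apply: (@integrable_fin_num _ _ _ mu X _ (EFin \o phi)).
  exact: measurable_coded_shift.
exact: integrable_coded_shift.
Qed.

Lemma integral_phi_mixture mu mu1 mu2 (s t : R) :
  0 <= s -> 0 <= t ->
  (forall E, measurable E -> mu E = (s%:E * mu1 E + t%:E * mu2 E)%E) ->
  (\int[mu]_(x in X) (phi x)%:E = s%:E * \int[mu1]_(x in X) (phi x)%:E +
     t%:E * \int[mu2]_(x in X) (phi x)%:E)%E.
Proof.
move=> s0 t0 mix.
have mX := measurable_coded_shift G.
have mphi : measurable_fun X (fun x => (phi x)%:E).
  by apply/measurable_EFinP; exact: continuous_measurable_coded_shift.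
(* The positive and negative parts have finite integrals, so the final identity becomes one between
   real numbers. *)
have fp (nu : probability (fullshift A) R) :
    (\int[nu]_(x in X) (fun x => (phi x)%:E)^\+ x)%E \is a fin_num.
  by apply: integrable_pos_fin_num => //; exact: integrable_coded_shift.
have fn (nu : probability (fullshift A) R) :
    (\int[nu]_(x in X) (fun x => (phi x)%:E)^\- x)%E \is a fin_num.
  by apply: integrable_neg_fin_num => //; exact: integrable_coded_shift.
rewrite integralE [X in (s%:E * X)%E]integralE [X in (t%:E * X)%E]integralE.
rewrite (integral_mixture s0 t0 mX mix (measurable_funepos mphi))//.
rewrite (integral_mixture s0 t0 mX mix (measurable_funeneg mphi))//.
rewrite -(fineK (fp mu1)) -(fineK (fp mu2)) -(fineK (fn mu1)) -(fineK (fn mu2)).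
by rewrite -?(EFinB, EFinM, EFinD); congr EFin; ring.
Qed.

End continuous_on_coded_shift.

(** * Supports and periodic point measures *)

Section support.
Variables (R : realType) (A : alphabetType) (mu : probability (fullshift A) R).

(** Each point of the compact set [K] has a null open neighbourhood, and finitely many of these
    cover [K]. *)
Lemma negligible_off_support (K : set (fullshift A)) : closed K ->
  K `&` measure_support mu = set0 -> mu.-negligible K.
Proof.
move=> cK Ksupp.
have : compact K by apply: (subclosed_compact cK (@compact_fullshift A)).
rewrite compact_cover => /(_ _ [set U | open U /\ mu U = 0%E] id) [|x Kx|D' D'0 KD'].
- by move=> U [].
- have : ~ measure_support mu x.
    by move=> sx; suff : set0 x by []; rewrite -Ksupp.
  move=> /existsNP[U /not_implyP[oU /not_implyP[Ux /negP]]].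
  rewrite -leNgt measure_le0 => /eqP U0.
  by exists U.
- apply: (negligibleS KD'); rewrite /cover bigcup_fset.
  rewrite big_seq; elim/big_ind : _ => [|U V|U /D'0].
  + exact: negligible_set0.
  + exact: negligibleU.
  + rewrite inE => -[oU U0].
    by apply/negligibleP => //; exact: open_measurable_shift.
Qed.

Lemma periodic_point_measure_invariant :
  periodic_point_measure mu -> invariant_measure (@left_shift A) mu.
Proof.
move=> [x [n [n0 xn _ muE]]] B mB.
rewrite !muE//; last exact: (measurable_preimage (@measurable_left_shift A)).
congr (_ * _)%E; case: n n0 xn {muE} => // n _ xn.
(* The shift rotates the orbit: the last term on the left is the first one on the right because [x]
   has period [n]. *)
rewrite big_ord_recr [RHS]big_ord_recl /= addeC; congr (_ + _)%E.
  rewrite !diracE; congr ((_ : bool)%:R)%:E.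
  by apply/idP/idP; rewrite !inE /preimage /= -iterS xn.
Qed.

End support.

Section pressure.
Variables (R : realType) (A : alphabetType) (G : set (seq A)).
Variable phi : fullshift A -> R.
Hypothesis cphi : {within coded_shift G, continuous phi}.
Local Notation X := (coded_shift G).
Implicit Types mu : probability (fullshift A) R.

Lemma carried_by_coded_shift mu (Y : set (fullshift A)) :
  Y `<=` X -> carried_by mu Y -> mu X = 1%E.
Proof.
move=> YX muY; have mX := measurable_coded_shift G.
have := probability_setC mu mX.
rewrite (_ : mu (~` X) = 0%E); last first.
  apply: measure_negligible; first exact: measurableC.
  by apply: negligibleS muY; exact: subsetC.
by move=> /esym/eqP; rewrite sube_eq ?add0e// => /eqP.
Qed.

Lemma measure_pressure_mixture mu mu1 mu2 (s t : R) (M : \bar R) :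
  0 < s -> 0 < t -> s + t = 1 ->
  (forall E, measurable E -> fine (mu E) = s * fine (mu1 E) + t * fine (mu2 E)) ->
  invariant_measure (@left_shift A) mu ->
  invariant_measure (@left_shift A) mu1 ->
  invariant_measure (@left_shift A) mu2 ->
  (measure_pressure X phi mu1 <= M)%E ->
  (measure_pressure X phi mu2 <= M)%E ->
  (measure_pressure X phi mu <= M)%E.
Proof.
move=> s0 t0 st mix inv inv1 inv2 le1 le2.
have s0' := ltW s0; have t0' := ltW t0.
have := entropy_mix (@measurable_left_shift A) s0' t0' mix inv inv1 inv2.
have mixe E : measurable E -> mu E = (s%:E * mu1 E + t%:E * mu2 E)%E.
  move=> mE; rewrite -(fineK (fin_num_measure mu _ mE)) mix//.
  by rewrite EFinD !EFinM !fineK ?fin_num_measure.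
move=> ent_le; rewrite /measure_pressure.
rewrite (integral_phi_mixture cphi s0' t0' mixe).
apply: (@le_trans _ _ (s%:E * M + t%:E * M)%E); last first.
  case: M {le1 le2} => [m| |].
  - by rewrite -!EFinM -EFinD lee_fin -mulrDl st mul1r.
  - by rewrite leey.
  (* For [M] equal to minus infinity, the strict positivity of both weights is essential. *)
  - by rewrite !gt0_muleNy ?lte_fin.
apply: (le_trans (leeD2r _ ent_le)).
(* Distributivity is legitimate even for infinite entropies, because the integrals are finite. *)
rewrite addeACA -!muleDr ?fin_num_adde_defl ?integral_fin_num_coded_shift//.
by apply: leeD; apply: lee_wpmul2l; rewrite ?lee_fin.
Qed.

(** The splitting is made along a measurable [B] that agrees with [Xseq G] up to a null set. If [B]
    or its complement is null, [mu] itself is carried by one of the two parts; otherwise both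
    conditional measures are available. *)
Lemma Ptop_le_max : (Ptop X phi <= maxe (Pseq G phi) (Plim G phi))%E.
Proof.
apply: ub_ereal_sup => _ [mu [inv muX] <-].
have mX := measurable_coded_shift G.
have [B [mB seqB nB]] := Xseq_measurable G mu.
have mBC : measurable (~` B) by exact: measurableC.
have muXC : mu (~` X) = 0%E by rewrite probability_setC// muX subee.
have BfB : mu (B `\` @left_shift A @^-1` B) = 0%E.
  have mfB := measurable_preimage (@measurable_left_shift A) mB.
  apply: measure_negligible; first exact: measurableD.
  apply: negligibleS nB => x [Bx nfBx]; split => // seqx; apply: nfBx.
  exact/seqB/Xseq_left_shift.
have fBB := preimage_setD_null (@measurable_left_shift A) inv mB BfB.
have BCfBC : mu (~` B `\` @left_shift A @^-1` (~` B)) = 0%E.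
  by rewrite -[RHS]fBB; congr (mu _); rewrite preimage_setC setDE setCK setDE setIC.
have lim_negl : mu.-negligible (~` Xlim G `&` ~` B).
  apply: (@negligibleS _ _ _ mu (~` X)); last first.
    by apply/negligibleP => //; exact: measurableC.
  move=> x [nlim nBx] Xx; apply: nlim; split => // /seqB; exact: nBx.
have seq_negl : mu.-negligible (~` Xseq G `&` B).
  by rewrite setIC -setDE.
have [B0|B0] := eqVneq (mu B) 0%E.
  rewrite le_max; apply/orP; right; apply: ereal_sup_ubound.
  exists mu => //; split => //.
  apply: (@negligibleS _ _ _ mu ((~` Xlim G `&` ~` B) `|` B)).
    by move=> x nx; have [Bx|nBx] := pselect (B x); [right|left].
  by apply: negligibleU => //; exact/negligibleP.
have [BC0|BC0] := eqVneq (mu (~` B)) 0%E.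
  rewrite le_max; apply/orP; left; apply: ereal_sup_ubound.
  exists mu => //; split => //.
  apply: (@negligibleS _ _ _ mu ((~` Xseq G `&` B) `|` ~` B)).
    by move=> x nx; have [Bx|nBx] := pselect (B x); [left|right].
  by apply: negligibleU => //; exact/negligibleP.
have inv1 := conditional_measure_invariant (@measurable_left_shift A) inv mB B0 BfB.
have inv2 := conditional_measure_invariant (@measurable_left_shift A)
  inv mBC BC0 BCfBC.
have carried1 : carried_by (conditional_measure mu mB) (Xseq G).
  exact: negligible_conditional.
have carried2 : carried_by (conditional_measure mu mBC) (Xlim G).
  exact: negligible_conditional.
have mix := conditional_measure_mix mB mBC B0 BC0.
apply: (measure_pressure_mixture _ _ _ mix inv inv1 inv2).
- by rewrite fine_gt0// lt0e B0 measure_ge0 ltey_eq fin_num_measure.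
- by rewrite fine_gt0// lt0e BC0 measure_ge0 ltey_eq fin_num_measure.
- rewrite -fineD ?fin_num_measure// probability_setC//.
  by rewrite addeC subeK ?fin_num_measure.
- rewrite le_max; apply/orP; left; apply: ereal_sup_ubound.
  exists (conditional_measure mu mB) => //; split => //; split => //.
  by apply: carried_by_coded_shift carried1; exact: Xseq_coded_shift.
- rewrite le_max; apply/orP; right; apply: ereal_sup_ubound.
  exists (conditional_measure mu mBC) => //; split => //; split => //.
  by apply: carried_by_coded_shift carried2; exact: subDsetl.
Qed.

End pressure.

(** * Perturbing the potential *)

(** By [shift_dist_lt], this is the set of points at distance less than [theta ^+ n] from some point
    of [S]. It is clopen, as membership depends on finitely many coordinates. *)
Definition window_nbhs (A : alphabetType) (n : nat) (S : set (fullshift A)) :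
    set (fullshift A) :=
  [set y | exists2 x, S x & forall k : int, (`|k| <= n)%N -> y k = x k].

Section window_nbhs.
Variables (R : realType) (A : alphabetType) (n : nat) (S : set (fullshift A)).
Local Notation N := (window_nbhs n S).

Lemma sub_window_nbhs : S `<=` N.
Proof. by move=> x Sx; exists x. Qed.

Lemma open_window_nbhs : open N.
Proof.
apply: (@open_window _ n) => x y yx [z Sz xz]; exists z => // k kn.
by rewrite yx// xz.
Qed.

Lemma closed_window_nbhs : closed N.
Proof.
rewrite -[N]setCK; apply: open_closedC; apply: (@open_window _ n) => x y yx nNx.
by move=> [z Sz yz]; apply: nNx; exists z => // k kn; rewrite -yx// yz.
Qed.

Lemma continuous_indic_window_nbhs : continuous (\1_N : fullshift A -> R).
Proof.
move=> x; apply: (@cvg_near_cst _ _ _ _ (nbhs x)).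
have [Nx|nNx] := pselect (N x).
  have : nbhs x N by apply: open_nbhs_nbhs; split => //; exact: open_window_nbhs.
  by apply: filterS => y Ny; rewrite !indicE !mem_set.
have : nbhs x (~` N).
  by apply: open_nbhs_nbhs; split => //; apply: closed_openC; exact: closed_window_nbhs.
by apply: filterS => y nNy; rewrite !indicE !memNset.
Qed.

Lemma window_nbhs_far (theta : R) (T : set (fullshift A)) :
  0 < theta -> theta < 1 -> ((theta ^+ n)%:E <= set_dist theta S T)%E ->
  N `&` T = set0.
Proof.
move=> t0 t1 far; rewrite -subset0 => y [[x Sx yx] Ty].
have : (set_dist theta S T <= (shift_dist theta x y)%:E)%E.
  by apply: ereal_inf_lbound; exists x => //; exists y.
move=> /(le_trans far); rewrite lee_fin leNgt => /negP; apply.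
exact/shift_dist_lt.
Qed.

End window_nbhs.

(** This turns a positive separation into a window radius. The bound is extended real because
    [set_dist] is infinite when one of the sets is empty, for instance when no invariant measure is
    carried by [Xlim G]. *)
Lemma expr_lt_ereal (R : realType) (theta : R) (e : \bar R) :
  0 < theta -> theta < 1 -> (0 < e)%E -> exists n, ((theta ^+ n)%:E <= e)%E.
Proof.
move=> t0 t1; case: e => [e e0| _|//]; last by exists 0%N; rewrite leey.
have : theta ^+ n @[n --> \oo] --> (0 : R) by apply: cvg_expr; rewrite gtr0_norm.
move=> /cvgrPdist_lt/(_ _ e0)[n _ /(_ n (leqnn _))] /=.
rewrite sub0r normrN ger0_norm ?exprn_ge0 ?ltW// => le_e.
by exists n; rewrite lee_fin ltW.
Qed.

Section pressure_perturbation.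
Variables (R : realType) (A : alphabetType) (G : set (seq A)).
Variable phi : fullshift A -> R.
Hypothesis cphi : {within coded_shift G, continuous phi}.
Local Notation X := (coded_shift G).
Implicit Types mu : probability (fullshift A) R.

Lemma integral_phi_le mu (M : R) : mu X = 1%E ->
  (forall x, X x -> `|phi x| <= M) ->
  (\int[mu]_(x in X) (phi x)%:E <= M%:E)%E.
Proof.
move=> muX MP; have mX := measurable_coded_shift G.
rewrite -[leRHS]mule1 -muX -integral_cst//; apply: le_integral => //.
- exact: integrable_coded_shift.
- by apply: finite_measure_integrable_cst.
- by move=> x /[!inE] Xx; rewrite lee_fin (le_trans _ (MP x Xx))// ler_norm.
Qed.

Lemma measure_pressure_add_indic mu (e : R) (N : set (fullshift A)) :
  measurable N ->
  measure_pressure X (fun x => phi x + e * \1_N x) mu =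
  (measure_pressure X phi mu + e%:E * mu (N `&` X))%E.
Proof.
move=> mN; have mX := measurable_coded_shift G.
have iN : mu.-integrable X (fun x => (\1_N x)%:E).
  by apply: (integrableS measurableT) => //; exact: integrable_indic.
rewrite /measure_pressure -addeA; congr (_ + _)%E.
under eq_integral do rewrite EFinD EFinM.
rewrite integralD//=; last 2 first.
- exact: integrable_coded_shift.
- exact: integrableZl.
by rewrite integralZl// integral_indic.
Qed.

End pressure_perturbation.

Unset Implicit Arguments.

Theorem proposition31 (R : realType) (A : alphabetType) (theta : R)
    (theta0 : 0 < theta) (theta1 : theta < 1)
    (G : set (seq A)) (countableG : countable G)
    (entropy_lim0 : forall mu : probability (fullshift A) R,
      invariant_measures R (coded_shift G) mu -> carried_by mu (Xlim G) ->
      entropy (@left_shift A) mu = 0%E)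
    (periodic_approx : forall phi : fullshift A -> R,
      continuous_functions R (coded_shift G) phi ->
      Ptop (coded_shift G) phi = Plim G phi ->
      exists mu_ : nat -> probability (fullshift A) R,
        [/\ forall k, periodic_point_measure (mu_ k) /\
                      carried_by (mu_ k) (Xseq G),
            forall k, (0 < set_dist theta (measure_support (mu_ k))
              (\bigcup_(mu in [set mu | invariant_measures R (coded_shift G) mu /\
                                        carried_by mu (Xlim G)]) measure_support mu))%E &
            measure_pressure (coded_shift G) phi (mu_ k) @[k --> \oo] -->
              Ptop (coded_shift G) phi]) :
  FSSP R G = continuous_functions R (coded_shift G).
Proof.
apply/seteqP; split => [phi []//|phi cphi]; split => //.
have [lt_lim_seq|le_seq_lim] := ltP (Plim G phi) (Pseq G phi).
  exact: subset_closure.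
have top_lim : Ptop (coded_shift G) phi = Plim G phi.
  apply/eqP; rewrite eq_le; apply/andP; split.
    by rewrite (le_trans (Ptop_le_max cphi))// ge_max le_seq_lim lexx.
  by apply: ereal_sup_le => _ [mu [muX _] <-]; exists mu.
have [mu_ [mu_seq far mu_cvg]] := periodic_approx phi cphi top_lim.
have mX := measurable_coded_shift G.
have mu_X k : invariant_measures R (coded_shift G) (mu_ k).
  have [per seq] := mu_seq k; split; first exact: periodic_point_measure_invariant.
  by apply: carried_by_coded_shift seq; exact: Xseq_coded_shift.
(* The lower bound comes from [mu_ 0], with nonnegative entropy and finite integral. The upper bound
   comes from [Plim], where entropy vanishes and [phi] is bounded. *)
have top_fin : Ptop (coded_shift G) phi \is a fin_num.
  rewrite fin_numElt; apply/andP; split.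
    apply: (@lt_le_trans _ _ (measure_pressure (coded_shift G) phi (mu_ 0%N))).
      rewrite /measure_pressure.
      rewrite -(fineK (integral_fin_num_coded_shift cphi (mu_ 0%N))).
      apply: lt_le_trans (leeD2r _
        (entropy_ge0 (@measurable_left_shift A) (mu_X 0%N).1)).
      by rewrite add0e ltNyr.
    by apply: ereal_sup_ubound; exists (mu_ 0%N).
  have [M MP] := continuous_bounded_coded_shift cphi.
  rewrite top_lim; apply: (@le_lt_trans _ _ M%:E); last by rewrite ltry.
  apply: ge_ereal_sup => _ [nu [nuX nulim] <-].
  rewrite /measure_pressure entropy_lim0// add0e.
  by apply: integral_phi_le => //; case: nuX.
move=> B /uniform_nbhs[E [entE EB]].
move: entE; rewrite -entourage_ballE => -[e /= e0 eE].
have e20 : 0 < e / 2 by rewrite divr_gt0.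
(* Otherwise the limit would give [Ptop <= Ptop - e / 2], impossible for a finite value. *)
have [k lt_k] : exists k, (Ptop (coded_shift G) phi - (e / 2)%:E <
    measure_pressure (coded_shift G) phi (mu_ k))%E.
  apply: contrapT => /forallNP le_k.
  have : (Ptop (coded_shift G) phi <= Ptop (coded_shift G) phi - (e / 2)%:E)%E.
    by apply: (cvge_le _ mu_cvg); apply: nearW => k; rewrite leNgt; apply/negP.
  by rewrite leNgt => /negP; apply; rewrite lteBlDr// lteDl// lte_fin.
have [n far_n] := expr_lt_ereal theta0 theta1 (far k).
set S := measure_support (mu_ k) in far_n.
set N := window_nbhs n S.
have mN : measurable N.
  by apply: open_measurable_shift; exact: open_window_nbhs.
(* [N] is closed and misses the support of [nu], by the choice of [n]. *)
have lim_N nu : invariant_measures R (coded_shift G) nu -> carried_by nu (Xlim G) ->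
    nu (N `&` coded_shift G) = 0%E.
  move=> nuX nulim; apply: measure_negligible; first exact: measurableI.
  apply: (@negligibleS _ _ _ nu N); first exact: subIsetl.
  apply: negligible_off_support; first exact: closed_window_nbhs.
  rewrite -subset0 -(window_nbhs_far theta0 theta1 far_n).
  by apply: setIS => x sx; exists nu.
(* Here it is the complement of [N] that is closed and misses the support of [mu_ k]. *)
have mu_N : mu_ k (N `&` coded_shift G) = 1%E.
  have [_ muX] := mu_X k.
  have -> : 1%E = mu_ k (coded_shift G) by [].
  apply: (eq_measure_mod_null (measurableI _ _ mN mX) mX).
    by rewrite setDE -setIA setICr setI0 measure0.
  apply: measure_negligible; first by apply: measurableD => //; exact: measurableI.
  apply: (@negligibleS _ _ _ (mu_ k) (~` N)).
    by move=> x [Xx nNX] Nx; apply: nNX.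
  apply: negligible_off_support; first apply: open_closedC.
    exact: open_window_nbhs.
  by rewrite -subset0 => x [nNx Sx]; apply: nNx; exact: sub_window_nbhs.
(* The height [e / 2] stays strictly inside the ball of radius [e] and exceeds the gap between
   [Ptop] and the pressure of [mu_ k]. *)
exists (fun x => phi x + e / 2 * \1_N x); split; last first.
  apply: EB => x Xx; apply: eE => /=.
  rewrite /ball /= opprD addrA subrr sub0r normrN normrM gtr0_norm//.
  rewrite (le_lt_trans (y := e / 2))//; last by lra.
  by rewrite ler_piMr ?(ltW e20)// indicE; case: (_ \in _); rewrite ?normr1 ?normr0.
split.
  move=> x; apply: cvgD; first exact: cphi.
  apply: cvgMl_tmp; apply: continuous_subspaceT x => x.
  exact: continuous_indic_window_nbhs.
(* The old [Ptop] separates the two new pressures: [Plim] has not grown beyond it, while the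
   pressure of [mu_ k] has gained [e / 2] and passed it. *)
apply: (@le_lt_trans _ _ (Ptop (coded_shift G) phi)).
  rewrite top_lim; apply: ge_ereal_sup => _ [nu [nuX nulim] <-].
  rewrite measure_pressure_add_indic// lim_N// mule0 adde0.
  by apply: ereal_sup_ubound; exists nu.
apply: (@lt_le_trans _ _ (measure_pressure (coded_shift G)
    (fun x => phi x + e / 2 * \1_N x) (mu_ k))).
  by rewrite measure_pressure_add_indic// mu_N mule1 -lteBlDr.
apply: ereal_sup_ubound; exists (mu_ k) => //; split=> //.
by have [] := mu_seq k.
Qed.
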